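(* Let $G$ be a finite group such that $G=A\rtimes D$, where $A$ is an abelian (normal) Hall subgroup of $G$ and $D$ is a Dedekind group. Suppose that every subgroup of $A$ is normal in $G$, and that for all $a\in A$ and $d\in D$, writing $a^d=a^n$ with $(n,o(a))=1$, either $n\equiv 1\pmod{o(a)}$ or $(n-1,o(a))=1$. Then $G$ is a PNC-group. In particular, for every $a\in A$ and every subgroup $H$ of $G$, either $a\in N_G(H)$ or $a\in H^G$.
   Context: For a subgroup $H$ of $G$, $H^G$ denotes the normal closure of $H$ in $G$. $H$ is an NC-subgroup of $G$ if $H^GN_G(H)=G$; $G$ is a PNC-group if every subgroup of $G$ is an NC-subgroup of $G$. A Dedekind group is a group all of whose subgroups are normal. $a^d=d^{-1}ad$, and $o(a)$ is the order of $a$. *)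

(* Defs.v *)
From mathcomp Require Import all_boot all_fingroup all_solvable.

Set Implicit Arguments.
Unset Strict Implicit.
Unset Printing Implicit Defensive.

Local Open Scope group_scope.

Section NCSubgroups.

Variable gT : finGroupType.
Implicit Types G H K : {group gT}.

(* H^G: the subgroup generated by all conjugates of H by elements of G. *)
Definition normal_closure (H G : {set gT}) : {set gT} := <<class_support H G>>.

Canonical normal_closure_group (H G : {set gT}) :=
  [group of normal_closure H G].

Definition NC_subgroup H G : Prop :=
  H \subset G /\ normal_closure H G * 'N_G(H) = G.

Definition PNC_group G : Prop :=
  forall H, H \subset G -> NC_subgroup H G.

Definition Dedekind_group G : Prop :=
  forall H, H \subset G -> H <| G.

End NCSubgroups.

(* Main.v *)
(* If some h in H moves a, with a^h = a^n, then [a, h] = a^(n-1) generates <a>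
   and lies in H^G; otherwise a centralizes H.  This gives A \subset H^G N_G(H).
   By Schur-Zassenhaus, H = (A :&: H)(D^x :&: H) for some x in A; both factors
   are normalized by D^x, and G = A D^x. *)
Require Import Defs.
From mathcomp Require Import all_boot all_fingroup all_solvable.

Local Open Scope group_scope.

(** Schur-Zassenhaus enters twice: its existence half splits [H] over the normal Hall subgroup
    [A :&: H], and its conjugacy half, with [A] solvable, moves the complement into a conjugate of
    [D] by an element of [A]. *)
Lemma sdprod_Hall_sub_conj {gT : finGroupType} {G A D H : {group gT}} :
    A ><| D = G -> Hall G A -> solvable A -> H \subset G ->
  exists2 x, x \in A & (A :&: H) * (D :^ x :&: H) = H.
Proof.
move=> defG hallA solA sHG.
have [nsAG _ mulAD nAD tiAD] := sdprod_context defG.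
have nAH : H \subset 'N(A) := subset_trans sHG (normal_norm nsAG).
have hallAH : Hall H (A :&: H).
  exact: pHall_Hall (setI_normal_Hall nsAG (Hall_pi hallA) sHG).
have nsAH : A :&: H <| H by rewrite setIC (normalGI sHG).
have /splitsP[K /complP[tiK defH]] := SchurZassenhaus_split hallAH nsAH.
have sKH : K \subset H by rewrite -defH mulG_subr.
(* Conjugacy needs complements of equal order, so [D] is cut down to [A <*> H]: by the modular law
   [L] is a complement of [A] in [A * H], just as [K] is. *)
pose L := (D :&: (A <*> H))%G.
have defAL : A * L = A * H.
  rewrite group_modl ?joing_subl // mulAD /= norm_joinEr //.
  by apply/setIidPr; rewrite mul_subG // normal_sub.
have defAK : A * K = A * H.
  by rewrite -[in RHS]defH mulgA (mulGSid (subsetIl A H)).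
have tiAK : A :&: K = 1.
  by rewrite -(setIidPr sKH) setIA.
have tiAL : A :&: L = 1 by rewrite setIA tiAD; apply/setIidPl/sub1G.
have cardKL : #|K| = #|L|.
  apply/eqP; rewrite -(eqn_pmul2l (cardG_gt0 A)).
  by rewrite -!TI_cardMg ?defAK ?defAL.
have coAL : coprime #|A| #|L|.
  apply: coprimegS (subsetIl _ _) _.
  by rewrite (coprime_sdprod_Hall_l defG).
have sKAL : K \subset A * L by rewrite defAL -defAK mulG_subr.
have nAL : L \subset 'N(A) by rewrite subIset ?nAD.
have [x Ax defK] := SchurZassenhaus_trans_sol solA nAL sKAL coAL cardKL.
(* Only the inclusion of [H] in the product needs work: [K = L :^ x] lies in [D :^ x]. *)
exists x => //; apply/eqP; rewrite eqEsubset mul_subG ?subsetIr //=.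
rewrite -{1}defH mulgS // subsetI sKH andbT defK.
by rewrite conjSg subsetIl.
Qed.

Lemma commg_normal_closure {gT : finGroupType} {G H : {group gT}} {a h : gT} :
  H \subset G -> a \in G -> h \in H -> [~ a, h] \in normal_closure H G.
Proof.
move=> sHG Ga Hh; rewrite commgEr groupM //; apply: mem_gen.
  by rewrite memJ_class_support ?groupV.
by rewrite -[h]conjg1 memJ_class_support.
Qed.

Lemma norm_or_normal_closure {gT : finGroupType} {G A D : {group gT}} :
    A ><| D = G -> abelian A ->
    (forall K : {group gT}, K \subset A -> K <| G) ->
    (forall (a d : gT) (n : nat), a \in A -> d \in D ->
       a ^ d = a ^+ n -> coprime n #[a] ->
       n = 1 %[mod #[a]] \/ coprime (n - 1) #[a]) ->
  forall (a : gT) (H : {group gT}), a \in A -> H \subset G ->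
  a \in 'N_G(H) \/ a \in normal_closure H G.
Proof.
move=> defG abelA normA expA a H Aa sHG.
have [nsAG _ mulAD nAD tiAD] := sdprod_context defG.
have Ga : a \in G := subsetP (normal_sub nsAG) a Aa.
have [cHa | ncHa] := boolP (a \in 'C(H)).
  by left; rewrite inE Ga (subsetP (cent_sub H)).
right; have /subsetPn[h Hh ncah] : ~~ (H \subset 'C[a]) by rewrite sub_cent1.
(* As [A] is abelian, [h] acts on [a] through its [D]-component [d] alone, which brings [expA] into
   play. *)
have /mulsgP[b d Ab Dd defh] : h \in A * D by rewrite mulAD (subsetP sHG).
have eq_ahd : a ^ h = a ^ d.
  by rewrite defh conjgM /conjg (centsP abelA _ Aa _ Ab) mulKg.
have /cyclePmin[n _ def_ad] : a ^ d \in <[a]>.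
  have /normal_norm/subsetP nCa : <[a]> <| G by apply: normA; rewrite cycle_subG.
  by rewrite -eq_ahd memJ_norm ?cycle_id // nCa ?(subsetP sHG).
(* Conjugation preserves orders, so [a ^ d] is again a generator of [<[a]>]. *)
have co_n : coprime n #[a].
  rewrite coprime_sym -generator_coprime -def_ad /generator eq_sym.
  by rewrite eqEcard cycle_subG def_ad mem_cycle -def_ad -!orderE orderJ /=.
have a_neq : a ^ h != a.
  by apply: contra ncah => /eqP/conjg_fixP/commgP/commute_sym/cent1P.
have [n1 | co_n1] := expA a d n Aa Dd def_ad co_n.
  case/eqP: a_neq; rewrite eq_ahd def_ad -[in RHS](expg1 a).
  by apply/eqP; rewrite eq_expg_mod_order n1.
(* If [n = 0], coprimality forces [a = 1], which [h] fixes; hence [n - 1] is a true subtraction. *)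
have n_gt0 : 0 < n.
  rewrite lt0n; apply: contraNneq a_neq => n0; move: co_n.
  by rewrite n0 /coprime gcd0n order_eq1 => /eqP->; rewrite conj1g.
have def_comm : [~ a, h] = a ^+ (n - 1).
  by rewrite commgEl eq_ahd def_ad -{1}(subnK n_gt0) addn1 expgS mulKg.
rewrite -cycle_subG; move: co_n1.
rewrite coprime_sym -generator_coprime => /eqP->; rewrite -def_comm cycle_subG.
exact: commg_normal_closure.
Qed.


(* The exponent n is a natural number; the truncated subtraction n - 1 is
   harmless, as n = 0 is coprime to #[a] only when #[a] = 1. *)
Theorem theorem4p8 (gT : finGroupType) (G A D : {group gT})
    (defG : A ><| D = G)
    (abelA : abelian A)
    (hallA : Hall G A)
    (dedD : Dedekind_group D)
    (normA : forall K : {group gT}, K \subset A -> K <| G)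
    (expA : forall (a d : gT) (n : nat), a \in A -> d \in D ->
       a ^ d = a ^+ n -> coprime n #[a] ->
       n = 1 %[mod #[a]] \/ coprime (n - 1) #[a]) :
  PNC_group G
  /\ (forall (a : gT) (H : {group gT}), a \in A -> H \subset G ->
        a \in 'N_G(H) \/ a \in normal_closure H G).
Proof.
have elt := norm_or_normal_closure defG abelA normA expA.
split=> // H sHG; split=> //.
have [nsAG _ mulAD nAD tiAD] := sdprod_context defG.
have sHcG : normal_closure H G \subset G.
  by rewrite gen_subG class_support_subG.
have nHcG : G \subset 'N(normal_closure H G).
  exact: subset_trans (class_support_norm H G) (norm_gen _).
(* This turns the product into a join, so that it suffices to place [A] and [D :^ x] inside it. *)
have nHcN : 'N_G(H) \subset 'N(normal_closure H G) by rewrite subIset ?nHcG.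
have [x Ax defH] := sdprod_Hall_sub_conj defG hallA (abelian_sol abelA) sHG.
have Gx : x \in G := subsetP (normal_sub nsAG) x Ax.
have sDxN : D :^ x \subset 'N_G(H).
  have sDG : D \subset G by rewrite -mulAD mulG_subr.
  have sDxG : D :^ x \subset G by rewrite -(conjGid Gx) conjSg.
  rewrite subsetI sDxG -defH normsM //.
    by rewrite (subset_trans sDxG) // normal_norm ?normA ?subsetIl.
  (* Conjugating back by [x] places the second factor inside [D], where every subgroup is normal. *)
  have -> : D :^ x :&: H = (D :&: H :^ x^-1) :^ x by rewrite conjIg conjsgKV.
  rewrite normJ conjSg normal_norm //.
  by apply: (dedD (D :&: H :^ x^-1)%G); apply: subsetIl.
have defADx : A * D :^ x = G by rewrite -{1}(conjGid Ax) -conjsMg mulAD conjGid.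
have sAM : A \subset normal_closure H G <*> 'N_G(H).
  apply/subsetP=> a Aa; have [aN | aHc] := elt a H Aa sHG.
    by rewrite mem_gen // inE aN orbT.
  by rewrite mem_gen // inE aHc.
rewrite -norm_joinEr //; apply/eqP; rewrite eqEsubset.
rewrite join_subG sHcG subsetIl /= -{1}defADx mul_subG //.
exact: subset_trans sDxN (joing_subr _ _).
Qed.
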